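(* Let $\Gamma$ be a strongly regular graph with parameters $(v,k,\lambda,\mu)$ and eigenvalues $k > r \geqslant s$. Then $$C_\Gamma\left(\lfloor -\mu/s \rfloor, \lfloor 2 - k/s \rfloor\right) < 0.$$
   Context: Graphs are finite, simple and undirected. A non-empty (having at least one edge) $k$-regular graph on $v$ vertices is edge-regular with parameters $(v,k,\lambda)$ if every pair of adjacent vertices has precisely $\lambda$ common neighbours. A strongly regular graph with parameters $(v,k,\lambda,\mu)$ is a non-complete edge-regular graph with parameters $(v,k,\lambda)$ such that every pair of distinct non-adjacent vertices has precisely $\mu$ common neighbours. Its adjacency matrix has at most three distinct eigenvalues, denoted $k > r \geqslant s$: $k$ is the valency, and $r$ and $s$ are the largest and smallest eigenvalues different from $k$ (with $r=s$ if there is only one eigenvalue different from $k$). For an edge-regular graph $\Gamma$ with parameters $(v,k,\lambda)$, the clique adjacency polynomial is $$C_\Gamma(x,y) := x(x+1)(v-y) - 2xy(k-y+1) + y(y-1)(\lambda-y+2).$$ *)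

(* Defs.v *)
From mathcomp Require Import all_boot all_order all_algebra.
From mathcomp Require Import reals.

Set Implicit Arguments.
Unset Strict Implicit.
Unset Printing Implicit Defensive.

Import Order.TTheory GRing.Theory Num.Theory.
Local Open Scope ring_scope.

Definition simple_graph (T : finType) (e : rel T) : Prop :=
  symmetric e /\ irreflexive e.

Definition neighbours (T : finType) (e : rel T) (x : T) : {set T} :=
  [set y | e x y].

Definition common_neighbours (T : finType) (e : rel T) (x y : T) : {set T} :=
  neighbours e x :&: neighbours e y.

Definition nonempty_graph (T : finType) (e : rel T) : Prop :=
  exists x y : T, e x y.

Definition complete_graph (T : finType) (e : rel T) : Prop :=
  forall x y : T, x != y -> e x y.

Definition regular_graph (T : finType) (e : rel T) (k : nat) : Prop :=
  forall x : T, #|neighbours e x| = k.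

Definition edge_regular (T : finType) (e : rel T) (v k lambda : nat) : Prop :=
  [/\ simple_graph e, nonempty_graph e, #|T| = v, regular_graph e k &
      forall x y : T, e x y -> #|common_neighbours e x y| = lambda].

Definition strongly_regular (T : finType) (e : rel T)
    (v k lambda mu : nat) : Prop :=
  [/\ edge_regular e v k lambda, ~ complete_graph e &
      forall x y : T, x != y -> ~~ e x y -> #|common_neighbours e x y| = mu].

Definition adjacency_matrix (R : realType) (T : finType) (e : rel T) :
    'M[R]_#|T| :=
  \matrix_(i, j) (e (enum_val i) (enum_val j))%:R.

(* [r] and [s] are the largest and the smallest eigenvalue of the adjacency
   matrix different from the valency [k]; they coincide when there is only one
   such eigenvalue. The inequality [r < k] is not required: it follows, as
   every eigenvalue of a k-regular graph is at most [k]. *)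
Definition restricted_eigenvalues (R : realType) (T : finType) (e : rel T)
    (k : nat) (r s : R) : Prop :=
  let A := adjacency_matrix R e in
  [/\ eigenvalue A r /\ r != k%:R,
      eigenvalue A s /\ s != k%:R &
      forall a : R, eigenvalue A a -> a != k%:R -> s <= a <= r].

Definition clique_adjacency_poly (v k lambda : nat) (x y : int) : int :=
  x * (x + 1) * (v%:Z - y) - 2 * x * y * (k%:Z - y + 1)
  + y * (y - 1) * (lambda%:Z - y + 2).

(* Main.v *)
Require Import Defs.
From mathcomp Require Import all_boot all_order all_algebra.
From mathcomp Require Import reals.
From mathcomp Require Import ring lra zify.

(** Suppose that the graph has a clique of [y] vertices, and let [d] be the
number of neighbours in the clique of a vertex outside it. Double counting
shows that [C(x, y)] is the sum of [(d - x) * (d - x - 1)] over the [v - y]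
outside vertices, so [C(x, y) < 0] at integers [x] and [y] excludes cliques of
size [y]. At [Y = 1 - k / s], the Delsarte-Hoffman bound, the polynomial
behaves as if every outside vertex had exactly [X = - mu / s] neighbours in
the clique: [C(x, Y) = (v - Y) * (x - X) * (x - X + 1)], which is at most [0]
for [X - 1 <= x <= X]. The arguments in the theorem are [x = X - a] with
[0 <= a < 1] and [y = Y + b] with [0 < b <= 1], so the point to prove is that
moving from [Y] to the next integer makes the value strictly negative.

Let [rho = lambda - mu - s] be the second root of the quadratic equation
satisfied by [s], and put [t = - s]. Then [X], [rho] and [t] parametrize
everything: [mu = t * X], [k = t * (X + rho)], [lambda = t * X + rho - t],
[Y = X + rho + 1] and [v * X = (k - rho) * Y]. With these substitutions
[cliqueC_hoffman_expand] expands [C(X - a, Y + b)].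

The expansion is not negative for all [a] and [b], and integrality of the
spectrum has to be used. The multiplicity of [rho] is the trace of an
idempotent matrix, hence a natural number, and this forces one of two cases
([int_or_conference]). If [rho] is an integer, then [X] and [Y] have the same
fractional part, so [b = 1 - a] ([cliqueC_lt0_integral]). Otherwise the graph
has the parameters [(4 * mu + 1, 2 * mu, mu - 1, mu)] of a conference graph,
where [X = rho], [t = X + 1] and [Y = 2 * X + 1], so that
[b <= 2 * (1 - a)] ([cliqueC_lt0_conference]).

The parametrization needs [mu > 0]. If [mu = 0] the graph is a disjoint union
of complete graphs, [s = -1], and the value is computed directly.

The quantities attached to [s] make sense because [s < 0]
([smallest_eigenvalue_lt0]). *)

Set Implicit Arguments.
Unset Strict Implicit.
Unset Printing Implicit Defensive.

Import Order.TTheory GRing.Theory Num.Theory.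
Local Open Scope ring_scope.

(** * Matrices satisfying the strongly regular quadratic relation *)

(** An idempotent factors as [C *m R] through its rank, and cancelling the full
rank factors in [E *m E = E] leaves [R *m C = 1], whose trace is the rank. *)
Lemma mxtrace_idempotent (F : fieldType) (n : nat) (E : 'M[F]_n) :
  E *m E = E -> \tr E = (\rank E)%:R.
Proof.
move=> EE.
have CR := mulmx_base E.
suff RC : row_base E *m col_base E = 1%:M.
  by rewrite -[in LHS]CR mxtrace_mulC RC mxtrace1.
apply: (row_full_inj (col_base_full E)); rewrite mulmx1.
apply: (row_free_inj (row_base_free E)).
by rewrite -mulmxA -mulmxA CR mulmxA CR EE.
Qed.

Section MatrixRelations.
Variables (F : fieldType) (n : nat) (A : 'M[F]_n) (k alpha beta mu : F).
Local Notation J := (const_mx 1 : 'M[F]_n).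
Hypothesis AJ : A *m J = k *: J.
Hypothesis JA : J *m A = k *: J.
Hypothesis A2 : A *m A = alpha *: A + beta%:M + mu *: J.

(** An eigenvector for [a != k] is orthogonal to the all-ones vector, so the
term [mu *: J] of the relation vanishes on it. *)
Lemma eigenvalue_quadratic a :
  eigenvalue A a -> a != k -> a ^+ 2 = alpha * a + beta.
Proof.
move=> /eigenvalueP[w wA w0] ak.
have wJ : w *m J = 0.
  apply/eqP; have : (a - k) *: (w *m J) == 0.
    by rewrite scalerBl scalemxAl -wA -mulmxA AJ -scalemxAr subrr.
  by rewrite scaler_eq0 subr_eq0 (negPf ak).
have : (a ^+ 2 - (alpha * a + beta)) *: w == 0.
  rewrite scalerBl expr2 -scalerA -{1}wA scalemxAl -wA -mulmxA A2.
  rewrite !mulmxDr -!scalemxAr wJ scaler0 addr0 wA mul_mx_scalar scalerA.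
  by rewrite -scalerDl subrr.
by rewrite scaler_eq0 (negPf w0) orbF subr_eq0 => /eqP.
Qed.

Lemma mul_shifts a b : a + b = alpha -> a * b = - beta ->
  (A - a%:M) *m (A - b%:M) = mu *: J.
Proof.
move=> sab pab.
rewrite mulmxBl !mulmxBr A2 mul_mx_scalar !mul_scalar_mx scale_scalar_mx pab -sab.
by apply/matrixP=> i j; rewrite !mxE; ring.
Qed.

(** If [A - b] is invertible it can be cancelled in
[(A - a) *m (A - b) = mu *: J], since [J] is one of its eigenmatrices. This is
how a root of the quadratic is shown to be an eigenvalue without
diagonalizing [A]. *)
Lemma shift_const_mx a b : a + b = alpha -> a * b = - beta -> b != k ->
  ~~ eigenvalue A b -> A - a%:M = (mu / (k - b)) *: J.
Proof.
move=> sab pab bk; rewrite /eigenvalue /eigenspace negbK kermx_eq0 => free.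
apply: (row_free_inj free); rewrite /= mul_shifts// -scalemxAl mulmxBr JA.
rewrite mul_mx_scalar -scalerBl scalerA divfK//.
by rewrite subr_eq0 eq_sym.
Qed.

(** The number [f] is the multiplicity of [b]: the matrix
[(A - a - c *: J) / (b - a)], with [c] chosen to kill the all-ones vector, is
the projector onto the eigenspace of [b] inside the complement of that
vector, and [f] is its rank. *)
Lemma trace_multiplicity a b : a + b = alpha -> a * b = - beta -> b != a ->
  n%:R != 0 :> F -> n%:R * mu = (k - a) * (k - b) -> \tr A = 0 ->
  exists f : nat, - a * n%:R - (k - a) = f%:R * (b - a).
Proof.
move=> sab pab ba n0 nmu trA.
have d0 : b - a != 0 by rewrite subr_eq0.
pose c := (k - a) / n%:R.
have cn : c * n%:R = k - a by rewrite divfK.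
have muc : mu = c * (k - b) by rewrite /c mulrAC -nmu mulrAC mulfV ?mul1r.
pose B := A - a%:M - c *: J.
have JJ : J *m J = n%:R *: J.
  apply/matrixP=> i j; rewrite !mxE (eq_bigr (fun=> 1)); last first.
    by move=> t _; rewrite !mxE mulr1.
  by rewrite sumr_const card_ord mulr1.
have BB : B *m B = (b - a) *: B.
  have -> : (b - a) *: B = B *m (b - a)%:M by rewrite mul_mx_scalar.
  apply/eqP; rewrite -subr_eq0 -mulmxBr.
  have -> : B - (b - a)%:M = A - b%:M - c *: J.
    by apply/matrixP=> i j; rewrite !mxE; ring.
  have AaJ : (A - a%:M) *m J = (k - a) *: J.
    by rewrite mulmxBl AJ mul_scalar_mx scalerBl.
  have JAb : J *m (A - b%:M) = (k - b) *: J.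
    by rewrite mulmxBr JA mul_mx_scalar scalerBl.
  rewrite /B mulmxBl !(mulmxBr _ _ (c *: J)) mul_shifts//.
  rewrite -!scalemxAr -!scalemxAl AaJ JAb JJ.
  rewrite muc !scalerA -!scalerBl.
  have -> : c * (k - b) - c * (k - a) - (c * (k - b) - c * c * n%:R) = 0.
    by rewrite -mulrA cn; ring.
  by rewrite scale0r.
exists (\rank ((b - a)^-1 *: B)).
rewrite -mxtrace_idempotent.
  rewrite linearZ /= mulrAC mulVf// mul1r /B !linearB /= linearZ /= trA.
  rewrite mxtrace_scalar /mxtrace (eq_bigr (fun=> 1)); last first.
    by move=> i _; rewrite !mxE.
  by rewrite sumr_const card_ord cn -mulr_natr; ring.
by rewrite -scalemxAl -scalemxAr BB [X in _ *: X]scalerA mulVf ?scale1r.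
Qed.

End MatrixRelations.

(** * Parameters and adjacency matrix of a strongly regular graph *)

Lemma sum_enum_val (R : pzRingType) (T : finType) (F : T -> R) :
  \sum_(i < #|T|) F (enum_val i) = \sum_x F x.
Proof. by rewrite [RHS](reindex _ (onW_bij _ (enum_val_bij T))). Qed.

Lemma sum_indicator (R : pzRingType) (T : finType) (P : pred T) :
  \sum_x (P x)%:R = #|[set x | P x]|%:R :> R.
Proof.
rewrite -natr_sum -sum1dep_card [in RHS]big_mkcond /=.
by congr _%:R; apply: eq_bigr => x _; case: (P x).
Qed.

Section Graph.
Variables (R : realType) (T : finType) (e : rel T) (v k l m : nat).
Hypothesis hG : strongly_regular e v k l m.
Local Notation A := (adjacency_matrix R e).
Local Notation J := (const_mx 1 : 'M[R]_#|T|).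

Lemma srg_sym : symmetric e. Proof. by case: hG => -[[]]. Qed.
Lemma srg_irr : irreflexive e. Proof. by case: hG => -[[]]. Qed.
Lemma srg_card : #|T| = v. Proof. by case: hG => -[]. Qed.
Lemma srg_regular x : #|neighbours e x| = k.
Proof. by case: hG => -[_ _ _ h _] _ _. Qed.

Lemma srg_edge : exists x y, e x y.
Proof. by case: hG => -[_ h _ _ _] _ _. Qed.

Lemma srg_nonedge : exists x y, x != y /\ ~~ e x y.
Proof.
have [_ nc _] := hG.
have [/existsP[x /existsP[y /andP[xy nxy]]]|h] :=
  boolP [exists x, exists y, (x != y) && ~~ e x y]; first by exists x, y.
case: nc => x y xy; apply: contraNT h => nxy.
by apply/existsP; exists x; apply/existsP; exists y; rewrite xy.
Qed.

Lemma srg_valency_gt0 : (0 < k)%N.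
Proof.
have [x [y xy]] := srg_edge.
by rewrite -(srg_regular x) card_gt0; apply/set0Pn; exists y; rewrite inE.
Qed.

Lemma srg_mu_le_valency : (m <= k)%N.
Proof.
have [x [y [xy nxy]]] := srg_nonedge.
have [_ _ /(_ x y xy nxy) <-] := hG.
by rewrite -(srg_regular x) subset_leq_card // subsetIl.
Qed.

Lemma srg_valency_lt : (k + 2 <= v)%N.
Proof.
have [x [y [xy nxy]]] := srg_nonedge.
rewrite -(srg_regular x) -srg_card -cardsT.
have <- : #|[set x; y]| = 2%N by rewrite cards2 xy.
rewrite -cardsUI; suff -> : neighbours e x :&: [set x; y] = set0.
  by rewrite cards0 addn0 subset_leq_card// subsetT.
apply/setP => z; rewrite !inE; have [->|_] := eqVneq z x.
  by rewrite srg_irr.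
by have [->|_] := eqVneq z y; rewrite ?(negPf nxy) ?andbF.
Qed.

Lemma adjacency_tr : A^T = A.
Proof. by apply/matrixP=> i j; rewrite !mxE srg_sym. Qed.

Lemma adjacency_mul_ones : A *m J = k%:R *: J.
Proof.
apply/matrixP=> i j; rewrite !mxE mulr1 -(srg_regular (enum_val i)).
rewrite -sum_indicator -[RHS]sum_enum_val.
by apply: eq_bigr => z _; rewrite !mxE mulr1.
Qed.

Lemma ones_mul_adjacency : J *m A = k%:R *: J.
Proof.
apply: trmx_inj; rewrite trmx_mul adjacency_tr linearZ /= trmx_const.
exact: adjacency_mul_ones.
Qed.

Lemma adjacency_trace : \tr A = 0.
Proof. by rewrite /mxtrace big1 // => i _; rewrite mxE srg_irr. Qed.

Lemma adjacency_sqr :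
  A *m A = (l%:R - m%:R) *: A + (k%:R - m%:R)%:M + m%:R *: J.
Proof.
apply/matrixP=> i j; rewrite !mxE mulr1.
have -> : \sum_t A i t * A t j
        = #|common_neighbours e (enum_val i) (enum_val j)|%:R.
  have -> x y : common_neighbours e x y = [set z | e x z && e y z].
    by apply/setP=> z; rewrite !inE.
  rewrite -sum_indicator -[RHS]sum_enum_val.
  apply: eq_bigr => t _; rewrite !mxE -natrM mulnb.
  by rewrite (srg_sym (enum_val t)).
have [_ _ mu_] := hG; have [[_ _ _ _ lambda_] _ _] := hG.
have [<-|ij] := eqVneq i j.
  by rewrite srg_irr /common_neighbours setIid srg_regular mulr1n mulr0 add0r subrK.
rewrite mulr0n addr0; case: (boolP (e _ _)) => eij.
  by rewrite lambda_// mulr1 subrK.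
by rewrite mu_ ?(inj_eq enum_val_inj)// mulr0 add0r.
Qed.

(** The off-diagonal entries of [A] are not all equal, because the graph has
both an edge and a non-edge. *)
Lemma adjacency_sub_scalar_neq a c : A - a%:M <> c *: J.
Proof.
move=> /matrixP h.
have off x y : x != y -> (e x y)%:R = c.
  move=> xy; have := h (enum_rank x) (enum_rank y).
  rewrite !mxE !enum_rankK (inj_eq enum_rank_inj) (negPf xy).
  by rewrite mulr0n subr0 mulr1.
have [x [y xy]] := srg_edge; have [x' [y' [nxy' nexy']]] := srg_nonedge.
have nxy : x != y by apply: contraTneq xy => ->; rewrite srg_irr.
have := off _ _ nxy'; rewrite -(off _ _ nxy) xy (negPf nexy') => /eqP.
by rewrite eq_sym oner_eq0.
Qed.

(** Both sides are the eigenvalue of [adjacency_sqr] on the all-ones vector.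
Equivalently, [k * (k - l - 1) = (v - k - 1) * m]. *)
Lemma srg_valency_eq :
  k%:R ^+ 2 = (l%:R - m%:R) * k%:R + (k%:R - m%:R) + m%:R * v%:R :> R.
Proof.
have [x _] := srg_edge.
have := congr1 (fun M : 'M_#|T| => (M *m J) (enum_rank x) (enum_rank x)) adjacency_sqr.
rewrite -mulmxA !mulmxDl adjacency_mul_ones -!scalemxAr -!scalemxAl.
rewrite adjacency_mul_ones mul_scalar_mx !mxE.
rewrite (eq_bigr (fun=> 1)) => [|t _]; last by rewrite !mxE mulr1.
by rewrite sumr_const card_ord srg_card !mulr1 -expr2.
Qed.

Lemma srg_lambda_lt : l%:R + 1 <= k%:R :> R.
Proof.
have k0 : 0 < k%:R :> R by rewrite ltr0n srg_valency_gt0.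
have vk : k%:R + 2 <= v%:R :> R by rewrite -[2]/(2%:R) -natrD ler_nat srg_valency_lt.
rewrite -subr_ge0 -(pmulr_rge0 _ k0).
have -> : k%:R * (k%:R - (l%:R + 1)) = m%:R * (v%:R - k%:R - 1) :> R.
  by have := srg_valency_eq; rewrite expr2 => H; rewrite mulrBr H; ring.
by rewrite mulr_ge0 ?ler0n//; lra.
Qed.

Variables (r s : R).
Hypothesis hrs : restricted_eigenvalues e k r s.

Lemma smallest_eigenvalue_eq :
  s ^+ 2 = (l%:R - m%:R) * s + (k%:R - m%:R).
Proof.
have [_ [es sk] _] := hrs.
exact: eigenvalue_quadratic adjacency_mul_ones adjacency_sqr _ es sk.
Qed.

(** If [s >= 0], the other root [th] of the quadratic is negative, as the
product of the roots is [m - k <= 0]. By minimality of [s] it is not an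
eigenvalue, and then [shift_const_mx] makes [A - s] a multiple of the all-ones
matrix, which the graph forbids. *)
Lemma smallest_eigenvalue_lt0 : s < 0.
Proof.
have [_ [es sk] s_min] := hrs.
have sE := smallest_eigenvalue_eq; have lk := srg_lambda_lt.
have mk : m%:R <= k%:R :> R by rewrite ler_nat srg_mu_le_valency.
rewrite ltNge; apply/negP => s0.
pose th : R := l%:R - m%:R - s.
have sth : s * th = m%:R - k%:R.
  by rewrite /th mulrBr -expr2 sE; ring.
have th0 : th < 0.
  (* For [s > 0], [th = 0] would give [m = k], so [s = l - k < 0]. *)
  have [s0'|s0'|s0'] := ltgtP 0 s.
  - have th_le : th <= 0 by rewrite -(pmulr_rle0 _ s0') sth subr_le0.
    rewrite lt_neqAle th_le andbT; apply/eqP => thE.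
    by move: sth; rewrite thE mulr0; move: thE; rewrite /th; lra.
  - by move: s0; rewrite leNgt s0'.
  - by move: sth; rewrite -s0' mul0r /th -s0'; lra.
have thk : th != k%:R by rewrite lt_eqF// (lt_le_trans th0)// ler0n.
have [eth|nth] := boolP (eigenvalue A th).
  by have /andP[] := s_min th eth thk; lra.
have sD : s + th = l%:R - m%:R by rewrite addrC subrK.
have sM : s * th = - (k%:R - m%:R) by rewrite sth opprB.
exact: adjacency_sub_scalar_neq
  (shift_const_mx ones_mul_adjacency adjacency_sqr sD sM thk nth).
Qed.

End Graph.

(** * The clique adjacency polynomial near the Delsarte-Hoffman bound *)

(** The clique adjacency polynomial with arguments and parameters in an
arbitrary ring, so that it can be evaluated at the non-integral bound. *)
Definition cliqueC (R : pzRingType) (v k l x y : R) : R :=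
  x * (x + 1) * (v - y) - 2 * x * y * (k - y + 1) + y * (y - 1) * (l - y + 2).

Lemma clique_adjacency_polyE (R : pzRingType) (v k l : nat) (x y : int) :
  (clique_adjacency_poly v k l x y)%:~R
  = cliqueC v%:R k%:R l%:R x%:~R y%:~R :> R.
Proof.
by rewrite /clique_adjacency_poly /cliqueC !(rmorphD, rmorphN, rmorphM).
Qed.

(** Expansion about the point [(X, Y)] with [Y = X + r + 1]. The first term is
the value [(v - Y) * (x - X) * (x - X + 1)] at [b = 0], as
[(v - Y) * X = (t - 1) * (X + r) * (X + r + 1)]; multiplying by [X] clears the
denominator of [v]. *)
Lemma cliqueC_hoffman_expand (R : realFieldType) (v t r X a b : R) :
  v * X = (t * (X + r) - r) * (X + r + 1) ->
  X * cliqueC v (t * (X + r)) (t * X + r - t) (X - a) (X + r + 1 + b)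
  = - (a * (1 - a) * (t - 1) * (X + r) * (X + r + 1))
    + b * X * ((t - 1) * ((1 + b) * (X - 1) - 2 * (1 - a) * (X + r))
               - (r + a + b) * (r + a + b + 1)).
Proof.
move=> hv; rewrite /cliqueC.
(* Only the product [v * X] is known, so it is isolated first. *)
have -> : forall x y z w : R, X * (x * (v - y) - z + w) =
   x * (v * X) - X * (x * y + z - w) by move=> *; ring.
rewrite hv; ring.
Qed.

(** With [b = 1 - a] the expansion is [-(1 - a)] times a sum of products of
nonnegative terms; the summand [X * (r + 1) * (r + 2)] makes it strict. *)
Lemma cliqueC_lt0_integral (R : realFieldType) (v t r X a : R) :
  0 < X -> 0 <= r -> 1 <= t -> 0 <= a < 1 ->
  v * X = (t * (X + r) - r) * (X + r + 1) ->
  cliqueC v (t * (X + r)) (t * X + r - t) (X - a) (X + r + 1 + (1 - a)) < 0.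
Proof.
move=> X0 r0 t1 /andP[a0 a1] hv.
rewrite -(pmulr_rlt0 _ X0) (cliqueC_hoffman_expand _ _ hv).
have -> : - (a * (1 - a) * (t - 1) * (X + r) * (X + r + 1))
    + (1 - a) * X * ((t - 1) * ((1 + (1 - a)) * (X - 1) - 2 * (1 - a) * (X + r))
               - (r + a + (1 - a)) * (r + a + (1 - a) + 1))
  = - ((1 - a) * ((t - 1) * (a * r * (2 * X + r + 1) +
                             2 * X * (1 + (1 - a) * r))
       + X * ((r + 1) * (r + 2)))) by ring.
rewrite oppr_lt0 mulr_gt0 ?subr_gt0// ltr_wpDl//; last first.
  by rewrite !mulr_gt0//; lra.
rewrite mulr_ge0 ?subr_ge0// addr_ge0// !mulr_ge0//; try lra.
by rewrite addr_ge0// mulr_ge0//; lra.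
Qed.

(** The case [r = X], [t = X + 1]. As a polynomial in [X], the expansion has
negative coefficients; for the leading one this is where
[b <= 2 * (1 - a)] enters, through [4 * (1 - a) - b >= 0]. *)
Lemma cliqueC_lt0_conference (R : realFieldType) (v X a b : R) :
  0 < X -> 0 <= a < 1 -> 0 < b <= 2 * (1 - a) ->
  v = (2 * X + 1) ^+ 2 ->
  cliqueC v ((X + 1) * (X + X)) ((X + 1) * X + X - (X + 1)) (X - a) (X + X + 1 + b) < 0.
Proof.
move=> X0 /andP[a0 a1] /andP[b0 b1] hv.
have hv' : v * X = ((X + 1) * (X + X) - X) * (X + X + 1) by rewrite hv; ring.
rewrite -(pmulr_rlt0 _ X0) (cliqueC_hoffman_expand _ _ hv').
have -> : - (a * (1 - a) * (X + 1 - 1) * (X + X) * (X + X + 1))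
    + b * X * ((X + 1 - 1) * ((1 + b) * (X - 1) - 2 * (1 - a) * (X + X))
               - (X + a + b) * (X + a + b + 1))
  = - (X * (X ^+ 2 * (4 * a * (1 - a) + b * (4 * (1 - a) - b))
     + (X * (2 * a * (1 - a) + b * (2 + 3 * b + 2 * a)) 
       + b * (a + b) * (a + b + 1)))) by ring.
rewrite oppr_lt0 mulr_gt0// ltr_wpDl//.
  rewrite mulr_ge0 ?sqr_ge0// addr_ge0// !mulr_ge0//; lra.
rewrite ltr_wpDl// ?mulr_gt0//; try lra.
rewrite mulr_ge0 ?addr_ge0// ?mulr_ge0//; lra.
Qed.

(** * Integrality of the second root *)

(** The rational root theorem for [x ^ 2 = p x + q] at [x = P / N]. Since
[(2 P - p N) ^ 2 = (p ^ 2 + 4 q) N ^ 2], [N] divides [2 P - p N]; a parity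
argument on the quotient [j] then removes the factor 2. *)
Lemma dvdz_int_root (p q P N : int) :
  N != 0 -> P ^+ 2 = p * P * N + q * N ^+ 2 -> (N %| P)%Z.
Proof.
move=> N0 PE.
have /dvdzP[j jE] : (N %| 2 * P - p * N)%Z.
  rewrite -(@dvdz_pexp2r _ _ 2)//; apply/dvdzP; exists (p ^+ 2 + 4 * q).
  have -> : (2 * P - p * N) ^+ 2 = 4 * P ^+ 2 - 4 * p * P * N + p ^+ 2 * N ^+ 2 by ring.
  by rewrite PE; ring.
have P2 : 2 * P = (j + p) * N by rewrite [RHS]mulrDl -jE; ring.
have jj : j ^+ 2 = p ^+ 2 + 4 * q.
  have N20 : N ^+ 2 != 0 by rewrite expf_neq0.
  apply: (mulIf N20); rewrite -exprMn -jE.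
  have -> : (2 * P - p * N) ^+ 2 = 4 * P ^+ 2 - 4 * p * P * N + p ^+ 2 * N ^+ 2 by ring.
  by rewrite PE; ring.
(* An odd [j + p] would make the discriminant [p ^ 2 + 4 q = j ^ 2] have the
   wrong residue modulo 4. *)
have [z zE] : exists z, j + p = 2 * z.
  exists ((j + p) %/ 2)%Z.
  have := divz_eq (j + p) 2.
  have : (0 <= (j + p) %% 2 < 2)%Z by rewrite modz_ge0//= ltz_pmod.
  set z := (_ %/ _)%Z; set w := (_ %% _)%Z => /andP[w0 w2] E.
  have {w0 w2} [w0|w1] : w = 0 \/ w = 1 by lia.
    by rewrite E w0; ring.
  have jE' : j = 2 * z + 1 - p by lia.
  move: jj; rewrite jE'.
  have -> : (2 * z + 1 - p) ^+ 2 = 4 * (z ^+ 2 + z - z * p) + 1 - 2 * p + p ^+ 2 by ring.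
  lia.
apply/dvdzP; exists z; apply: (@mulfI _ 2) => //.
by rewrite P2 zE; ring.
Qed.

Lemma int_of_rational_root (R : realFieldType) (p q P N : int) (x : R) :
  x ^+ 2 = p%:~R * x + q%:~R -> N != 0 -> x * N%:~R = P%:~R ->
  exists z : int, x = z%:~R.
Proof.
move=> xE N0 xN.
have NR0 : N%:~R != 0 :> R by rewrite intr_eq0.
have : P ^+ 2 = p * P * N + q * N ^+ 2.
  apply: (@intr_inj R); rewrite !(rmorphXn, rmorphD, rmorphM) /= -xN exprMn xE.
  ring.
move/(dvdz_int_root N0)/dvdzP => [z zE].
by exists z; apply: (mulIf NR0); rewrite xN zE rmorphM.
Qed.

(** The trace formula reads [rho * (v - 1 - 2 f) = k + (l - m) * (v - 1 - f)],
with integers everywhere but in [rho]. Either it makes [rho] rational, hence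
an integer, or both sides vanish, and then [2 k = (m - l) * (v - 1)]; as
[0 < k < v - 1] this leaves only [m - l = 1]. *)
Lemma int_or_conference (R : realType) (T : finType) (e : rel T)
    (v k l m : nat) (r s : R) :
  strongly_regular e v k l m -> restricted_eigenvalues e k r s ->
  (exists z : int, l%:R - m%:R - s = z%:~R) \/
  [/\ v%:R = 2 * k%:R + 1 :> R, l%:R - m%:R = -1 :> R & k%:R = 2 * m%:R :> R].
Proof.
move=> hG hrs.
have sE := smallest_eigenvalue_eq hG hrs.
have s0 := smallest_eigenvalue_lt0 hG hrs.
have kE := srg_valency_eq R hG.
have k0 := srg_valency_gt0 hG; have kv := srg_valency_lt hG.
have mk : m%:R <= k%:R :> R by rewrite ler_nat (srg_mu_le_valency hG).
pose rho := l%:R - m%:R - s; rewrite -/rho.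
have sD : s + rho = l%:R - m%:R by rewrite addrC subrK.
have sM : s * rho = - (k%:R - m%:R) by rewrite /rho mulrBr -expr2 sE; ring.
have rho0 : 0 <= rho by rewrite -(nmulr_rle0 _ s0) sM; lra.
have rhos : rho != s by rewrite gt_eqF// (lt_le_trans s0).
have T0 : #|T|%:R != 0 :> R by rewrite (srg_card hG) pnatr_eq0; lia.
have vM : #|T|%:R * m%:R = (k%:R - s) * (k%:R - rho) :> R.
  have -> : (k%:R - s) * (k%:R - rho) = k%:R ^+ 2 - (s + rho) * k%:R + s * rho by ring.
  by rewrite (srg_card hG) sD sM kE; ring.
have [f] := trace_multiplicity (adjacency_mul_ones R hG) (ones_mul_adjacency R hG)
  (adjacency_sqr R hG) sD sM rhos T0 vM (adjacency_trace R hG).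
rewrite (srg_card hG) => fE.
have lmZ : (l%:Z - m%:Z)%:~R = s + rho :> R by rewrite sD rmorphB.
have kmZ : (k%:Z - m%:Z)%:~R = - (s * rho) :> R by rewrite sM opprK rmorphB.
have fE' : rho * (v%:Z - 1 - 2 * f%:Z)%:~R
  = (k%:Z + (l%:Z - m%:Z) * (v%:Z - 1 - f%:Z))%:~R.
  rewrite [RHS]intrD [X in _ = _ + X]intrM lmZ !(rmorphD, rmorphN, rmorphM) /=.
  apply/eqP; rewrite -subr_eq0; apply/eqP.
  transitivity (- s * v%:R - (k%:R - s) - f%:R * (rho - s)); last by rewrite fE subrr.
  by ring.
have rhoE : rho ^+ 2 = (l%:Z - m%:Z)%:~R * rho + (k%:Z - m%:Z)%:~R.
  by rewrite lmZ kmZ; ring.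
have [N0|N0] := eqVneq (v%:Z - 1 - 2 * f%:Z) 0; last first.
  by left; apply: int_of_rational_root rhoE N0 fE'.
right; move: fE' => /esym/eqP; rewrite N0 mulr0 intr_eq0 => /eqP fk.
have kf : 2 * k%:Z = (m%:Z - l%:Z) * (v%:Z - 1) by nia.
have lm : l%:Z - m%:Z = -1 by nia.
have vk : v = (2 * k + 1)%N by move: kf lm; nia.
have lmR : l%:R - m%:R = -1 :> R.
  by have := congr1 (intr : int -> R) lm; rewrite rmorphB.
split => //; first by rewrite vk natrD natrM.
have kR0 : k%:R != 0 :> R by rewrite pnatr_eq0 -lt0n.
apply: (mulfI kR0); rewrite -expr2 kE lmR vk natrD natrM; ring.
Qed.

(** * The theorem *)

Theorem theorem4p2 (R : realType) (T : finType) (e : rel T)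
    (v k lambda mu : nat) (r s : R)
    (hG : strongly_regular e v k lambda mu)
    (hrs : restricted_eigenvalues e k r s) :
  clique_adjacency_poly v k lambda
    (Num.floor (- mu%:R / s)) (Num.floor (2 - k%:R / s)) < 0.
Proof.
have sE := smallest_eigenvalue_eq hG hrs.
have s0 := smallest_eigenvalue_lt0 hG hrs.
have kE := srg_valency_eq R hG.
have k0 := srg_valency_gt0 hG; have lk := srg_lambda_lt R hG.
have mk : mu%:R <= k%:R :> R by rewrite ler_nat (srg_mu_le_valency hG).
rewrite -(ltrz0 R) clique_adjacency_polyE.
have [mu0|mu0] := posnP mu.
  (* Here [lambda = k - 1] and [s = -1], so the value is [C(0, k + 2)]. *)
  have kR0 : k%:R != 0 :> R by rewrite pnatr_eq0 -lt0n.
  have lE : lambda%:R = k%:R - 1 :> R.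
    apply: (mulIf kR0); move: kE; rewrite mu0 mul0r addr0 !subr0 => kE.
    by rewrite mulrBl -expr2 kE; ring.
  have s1 : s = -1.
    have : (s - k%:R) * (s + 1) = 0.
      by move: sE; rewrite lE mu0 !subr0 => sE; rewrite mulrDr mulrBl -expr2 sE; ring.
    move/eqP; rewrite mulf_eq0 => /orP[|]; last by move=> /eqP; lra.
    by rewrite subr_eq0 => /eqP sk; have := ler0n R k; rewrite -sk leNgt s0.
  rewrite s1 mu0 oppr0 mul0r floor0 invrN1 mulrN1 opprK.
  have -> : 2 + k%:R = (2 + k%:Z)%:~R :> R by rewrite rmorphD.
  rewrite intrKfloor /cliqueC lE rmorphD /=.
  have := ler0n R k; nra.
pose t := - s; pose rho := lambda%:R - mu%:R - s; pose X := mu%:R / t : R.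
have t0 : 0 < t by rewrite oppr_gt0.
have X0 : 0 < X by rewrite divr_gt0// ltr0n.
have tX : t * X = mu%:R by rewrite mulrC divfK// gt_eqF.
have trho : t * rho = k%:R - mu%:R.
  by rewrite /t /rho mulNr mulrBr -expr2 sE; ring.
have rho0 : 0 <= rho by rewrite -(pmulr_rge0 _ t0) trho subr_ge0.
have kX : k%:R = t * (X + rho) by rewrite mulrDr tX trho; ring.
have lX : lambda%:R = t * X + rho - t by rewrite tX /rho /t; ring.
have t1 : 1 <= t.
  have : 0 <= (rho + 1) * (t - 1).
    have -> : (rho + 1) * (t - 1) = k%:R - (lambda%:R + 1) by rewrite kX lX; ring.
    by rewrite subr_ge0.
  by rewrite pmulr_rge0 ?subr_ge0//; lra.
have vX : v%:R * X = (t * (X + rho) - rho) * (X + rho + 1).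
  have tn0 : t != 0 by rewrite gt_eqF.
  apply: (mulfI tn0); rewrite mulrCA tX -kX.
  have -> : t * ((k%:R - rho) * (X + rho + 1)) = (k%:R - rho) * (k%:R + t).
    by rewrite kX; ring.
  have -> : (k%:R - rho) * (k%:R + t) =
     k%:R ^+ 2 - (lambda%:R - mu%:R) * k%:R - t * rho by rewrite /rho /t; ring.
  by rewrite kE trho; ring.
have -> : - mu%:R / s = X by rewrite /X /t invrN mulrN mulNr.
have -> : 2 - k%:R / s = X + rho + 2.
  have -> : k%:R / s = - (X + rho).
    by rewrite kX mulrAC /t mulNr divff ?lt_eqF// mulN1r.
  by rewrite opprK addrC.
have /andP[xX Xx] := floor_itv X; set x := Num.floor X in xX Xx *.
rewrite rmorphD /= in Xx.
pose a := X - x%:~R.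
have a01 : 0 <= a < 1 by rewrite /a; lra.
have xE : x%:~R = X - a by rewrite /a; ring.
(* In the integral case [y = x + rho + 2], that is [b = 1 - a]. *)
case: (int_or_conference hG hrs) => [[z rhoz]|[vk lm km]].
  have -> : Num.floor (X + rho + 2) = x + (z + 2).
    rewrite -addrA.
    have -> : rho + 2 = (z + 2)%:~R by rewrite rmorphD /= -rhoz.
    by rewrite floorDrz ?intr_int// intrKfloor.
  have -> : (x + (z + 2))%:~R = X + rho + 1 + (1 - a).
    by rewrite !rmorphD /= -rhoz -/rho xE; ring.
  by rewrite xE kX lX; apply: cliqueC_lt0_integral.
have tE : t = rho + 1 by move: lm; rewrite /t /rho; lra.
have Xrho : X = rho.
  have tn0 : t != 0 by rewrite gt_eqF.
  by apply: (mulfI tn0); rewrite tX trho km; ring.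
have /andP[yX Xy] := floor_itv (X + rho + 2).
set y := Num.floor _ in yX Xy *.
(* [y <= 2 * X + 2 < 2 * x + 4], and [y] is an integer. *)
have yx : y <= 2 * x + 3.
  rewrite -ltzD1 -(ltr_int R) !(rmorphD, rmorphM) /=.
  by rewrite (le_lt_trans yX)// -Xrho; lra.
have yxR : y%:~R <= 2 * x%:~R + 3 :> R.
  by move: yx; rewrite -(ler_int R) !(rmorphD, rmorphM).
rewrite rmorphD /= in Xy.
have -> : y%:~R = X + X + 1 + (y%:~R - (X + X + 1)) by ring.
rewrite xE kX lX -Xrho tE -Xrho; apply: cliqueC_lt0_conference => //.
  by move: yX Xy yxR; rewrite -Xrho xE; lra.
by rewrite vk kX tE -Xrho; ring.
Qed.
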